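(* The slant normal magnetic curves $\gamma=(\gamma_1,\dots,\gamma_{2n+s})$ on $\mathbb{R}^{2n+s}(-3s)$ satisfying the Lorentz equation $\nabla_TT=-q\varphi T$ (where $T=\gamma'$) have the parametric equations a) $$\gamma_i(t)=\frac{c_i}{-\lambda}\sin f_i(t)+b_i,$$ $$\gamma_{n+i}(t)=\frac{c_i}{\lambda}\cos f_i(t)+d_i,$$ $$\gamma_{2n+\alpha}(t)=2t\cos\theta-\sum_{i=1}^n\left\{\frac{c_i^2}{4\lambda^2}\left[\sin(2f_i(t))+2f_i(t)\right]+\frac{c_id_i}{\lambda}\sin f_i(t)\right\}+h_\alpha,$$ $$f_i(t)=-\lambda t+a_i,\qquad \alpha=1,\dots,s,\quad i=1,2,\dots,n,$$ $$\lambda=-q+2s\cos\theta\neq0,$$ where $a_i$, $b_i$, $c_i$, $d_i$ and $h_\alpha$ are arbitrary constants such that the $c_i$ satisfy $$c_1^2+\dots+c_n^2=4\left(1-s\cos^2\theta\right);$$ or b) $$\gamma_i(t)=c_it+d_i,\qquad i=1,\dots,2n,$$ $$\gamma_{2n+\alpha}(t)=2t\cos\theta+\sum_{i=1}^nc_i\left(\frac{c_{n+i}}{2}t^2+d_{n+i}t\right)+h_\alpha,\qquad \alpha=1,\dots,s,$$ where $c_i$, $d_i$ and $h_\alpha$ are arbitrary constants such that the $c_i$ satisfy $$c_1^2+\dots+c_{2n}^2=4\left(1-s\cos^2\theta\right).$$ In both cases, $q\neq0$ is a constant and $\theta$ denotes the constant contact angle, satisfying $|\cos\theta|\le\frac1{\sqrt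 s}$.
   Context: $\mathbb{R}^{2n+s}(-3s)$ denotes $\mathbb{R}^{2n+s}$ with coordinates $(x_1,\dots,x_n,y_1,\dots,y_n,z_1,\dots,z_s)$ and the structure $$\xi_\alpha=2\frac{\partial}{\partial z_\alpha},\qquad \eta^\alpha=\frac12\left(dz_\alpha-\sum_{i=1}^ny_i\,dx_i\right)\quad(\alpha=1,\dots,s),$$ $$\varphi X=\sum_{i=1}^nY_i\frac{\partial}{\partial x_i}-\sum_{i=1}^nX_i\frac{\partial}{\partial y_i}+\left(\sum_{i=1}^nY_iy_i\right)\left(\sum_{\alpha=1}^s\frac{\partial}{\partial z_\alpha}\right)$$ for $X=\sum_i\left(X_i\frac{\partial}{\partial x_i}+Y_i\frac{\partial}{\partial y_i}\right)+\sum_\alpha Z_\alpha\frac{\partial}{\partial z_\alpha}$, and Riemannian metric $$g=\sum_{\alpha=1}^s\eta^\alpha\otimes\eta^\alpha+\frac14\sum_{i=1}^n(dx_i\otimes dx_i+dy_i\otimes dy_i).$$ $\nabla$ is the Levi-Civita connection of $g$. (This is an $S$-manifold of constant $\varphi$-sectional curvature $-3s$.) The curve components $\gamma_1,\dots,\gamma_n$ are the $x$-coordinates, $\gamma_{n+1},\dots,\gamma_{2n}$ the $y$-coordinates, and $\gamma_{2n+1},\dots,\gamma_{2n+s}$ the $z$-coordinates; $t$ is the arc-length parameter. A normal magnetic curve (for the contact magnetic field $F_q=q\Omega$, $\Omega(X,Y)=g(X,\varphi Y)$) is a unit-speed curve $\gamma$ with tangent $T=\gamma'$ satisfying $\nabla_TT=-q\varphi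 T$. A unit-speed curve is slant with contact angle $\theta$ if $\theta$ is a constant angle with $\eta^\alpha(T)=\cos\theta$ for all $\alpha=1,\dots,s$. *)

(* Defs.v *)
From mathcomp Require Import all_boot all_order all_algebra.
From mathcomp Require Import all_classical all_reals all_analysis.
From mathcomp Require Import ring lra.
Set Implicit Arguments.
Unset Strict Implicit.
Unset Printing Implicit Defensive.
Import Order.TTheory GRing.Theory Num.Theory.
Import numFieldNormedType.Exports.
Local Open Scope classical_set_scope.
Local Open Scope ring_scope.

(* Riemannian geometry in one global chart. Points of R^m and tangent vectors
   (written in the coordinate frame) are both row vectors; a Riemannian metric
   is given by its Gram matrix [g p] in the coordinate frame, and a connection
   by its coefficients, [G p i j k] being the [k]-th component of the covariant
   derivative of the [j]-th coordinate field along the [i]-th one. *)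

Definition partial (R : realType) (m : nat) (f : 'rV[R]_m -> R) (k : 'I_m)
  (p : 'rV[R]_m) : R := 'D_(delta_mx 0 k) f p.

Definition torsion_free (R : realType) (m : nat)
    (G : 'rV[R]_m -> 'I_m -> 'I_m -> 'I_m -> R) : Prop :=
  forall p i j k, G p i j k = G p j i k.

Definition metric_compatible (R : realType) (m : nat)
    (g : 'rV[R]_m -> 'M[R]_m) (G : 'rV[R]_m -> 'I_m -> 'I_m -> 'I_m -> R)
    : Prop :=
  forall p i j k, partial (fun x => g x i j) k p =
    \sum_(l < m) (G p k i l * g p l j + G p k j l * g p i l).

(* The connection coefficients of the Levi-Civita connection; the lemma
   [christoffelP] below shows that, for a symmetric invertible [g], they are
   the only torsion-free and metric-compatible ones. *)
Definition christoffel (R : realType) (m : nat) (g : 'rV[R]_m -> 'M[R]_m)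
    (p : 'rV[R]_m) (i j k : 'I_m) : R :=
  2^-1 * \sum_(l < m) invmx (g p) k l *
    (partial (fun x => g x j l) i p + partial (fun x => g x i l) j p
     - partial (fun x => g x i j) l p).

(* Covariant derivative of the vector field [V] along the curve [gamma]. *)
Definition cov_deriv (R : realType) (m : nat) (g : 'rV[R]_m -> 'M[R]_m)
    (gamma V : R -> 'rV[R]_m) (t : R) : 'rV[R]_m :=
  \row_(k < m) ((derive1 V t : 'rV[R]_m) 0 k +
    \sum_(i < m) \sum_(j < m) christoffel g (gamma t) i j k
      * (derive1 gamma t : 'rV[R]_m) 0 i * V t 0 j).

(* For an open set [I] this is smoothness of [gamma] on [I]. *)
Definition smooth_on (R : realType) (m : nat) (I : set R)
    (gamma : R -> 'rV[R]_m) : Prop :=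
  forall (k : nat) (t : R), I t -> derivable (derive1n k gamma) t 1.

(* Positions of the coordinates x_i, y_i and z_a among the n + n + s ones. *)
Definition ix (n s : nat) (i : 'I_n) : 'I_(n + n + s) := lshift s (lshift n i).
Definition iy (n s : nat) (i : 'I_n) : 'I_(n + n + s) := lshift s (rshift n i).
Definition iz (n s : nat) (a : 'I_s) : 'I_(n + n + s) := rshift (n + n) a.

Definition eta (R : realType) (n s : nat) (a : 'I_s)
    (p X : 'rV[R]_(n + n + s)) : R :=
  2^-1 * (X 0 (iz n a) - \sum_(i < n) p 0 (iy s i) * X 0 (ix s i)).

Definition phi (R : realType) (n s : nat) (p X : 'rV[R]_(n + n + s))
    : 'rV[R]_(n + n + s) :=
  \sum_(i < n) X 0 (iy s i) *: delta_mx 0 (ix s i)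
  - \sum_(i < n) X 0 (ix s i) *: delta_mx 0 (iy s i)
  + (\sum_(i < n) X 0 (iy s i) * p 0 (iy s i))
      *: \sum_(a < s) delta_mx 0 (iz n a).

Definition metric (R : realType) (n s : nat) (p X Y : 'rV[R]_(n + n + s)) : R :=
  \sum_(a < s) eta a p X * eta a p Y
  + 4^-1 * \sum_(i < n) (X 0 (ix s i) * Y 0 (ix s i)
                         + X 0 (iy s i) * Y 0 (iy s i)).

Definition gram (R : realType) (n s : nat) (p : 'rV[R]_(n + n + s))
    : 'M[R]_(n + n + s) :=
  \matrix_(i, j) metric p (delta_mx 0 i) (delta_mx 0 j).

Definition unit_speed_on (R : realType) (n s : nat) (I : set R)
    (gamma : R -> 'rV[R]_(n + n + s)) : Prop :=
  forall t, I t -> metric (gamma t) (derive1 gamma t) (derive1 gamma t) = 1.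

Definition normal_magnetic_on (R : realType) (n s : nat) (q : R) (I : set R)
    (gamma : R -> 'rV[R]_(n + n + s)) : Prop :=
  [/\ smooth_on I gamma, unit_speed_on I gamma &
      forall t, I t -> cov_deriv (@gram R n s) gamma (derive1 gamma) t
                       = - q *: phi (gamma t) (derive1 gamma t)].

Definition slant_on (R : realType) (n s : nat) (theta : R) (I : set R)
    (gamma : R -> 'rV[R]_(n + n + s)) : Prop :=
  forall t, I t -> forall a : 'I_s,
    eta a (gamma t) (derive1 gamma t) = cos theta.

Lemma christoffelP (R : realType) (m : nat) (g : 'rV[R]_m -> 'M[R]_m)
    (G : 'rV[R]_m -> 'I_m -> 'I_m -> 'I_m -> R) :
  (forall p, (g p)^T = g p) -> (forall p, g p \in unitmx) ->
  torsion_free G /\ metric_compatible g G <->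
  forall p i j k, G p i j k = christoffel g p i j k.
Proof.
move=> gsym gunit.
have gC p i j : g p i j = g p j i by rewrite -{1}gsym mxE.
have dC i j k p : partial (fun x => g x i j) k p = partial (fun x => g x j i) k p.
  by have -> : (fun x => g x i j) = (fun x => g x j i) by apply/funext => x.
pose K p i j l := partial (fun x => g x j l) i p + partial (fun x => g x i l) j p
     - partial (fun x => g x i j) l p.
have invK p (u v : 'I_m -> R) :
    (forall l, \sum_k u k * g p k l = v l) <->
    (forall k, u k = \sum_l invmx (g p) k l * v l).
  split=> H.
  - have E : \row_l v l = (\row_k u k) *m g p.
      by apply/rowP => l; rewrite !mxE -H; apply: eq_bigr => k _; rewrite mxE.
    have : (\row_l v l) *m invmx (g p) = \row_k u k by rewrite E mulmxK.
    move/rowP => F k; have := F k; rewrite !mxE => <-.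
    apply: eq_bigr => l _; rewrite mxE mulrC; congr (_ * _).
    by rewrite -[in RHS](gsym p) -trmx_inv mxE.
  - have E : \row_k u k = (\row_l v l) *m invmx (g p).
      apply/rowP => k; rewrite !mxE H; apply: eq_bigr => l _.
      by rewrite mxE mulrC; congr (_ * _); rewrite -[in RHS](gsym p) -trmx_inv mxE.
    have : (\row_k u k) *m g p = \row_l v l by rewrite E mulmxKV.
    move/rowP => F l; have := F l; rewrite !mxE => <-.
    by apply: eq_bigr => k _; rewrite mxE.
have chE p i j k : christoffel g p i j k
    = \sum_l invmx (g p) k l * (2^-1 * K p i j l).
  by rewrite /christoffel big_distrr /=; apply: eq_bigr => l _; rewrite /K mulrCA.
split.
- move=> [tf mc] p i j k; rewrite chE; move: k; apply/invK => l.
  have mc' a b c : partial (fun x => g x a b) c p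
      = \sum_k G p c a k * g p k b + \sum_k G p c b k * g p k a.
    rewrite mc big_split /=; congr (_ + _).
    by apply: eq_bigr => k _; rewrite (gC p a).
  rewrite /K !mc'.
  have T a b c : \sum_k G p a b k * g p k c = \sum_k G p b a k * g p k c.
    by apply: eq_bigr => k _; rewrite tf.
  by rewrite (T j i) (T l j) (T l i); field.
- move=> H; have low p i j l : \sum_k G p i j k * g p k l = 2^-1 * K p i j l.
    by move: l; apply/invK => k; rewrite H chE.
  split=> [p i j k|p i j k].
    rewrite !H !chE; apply: eq_bigr => l _; congr (_ * (_ * _)).
    by rewrite /K (dC i j) [X in X - _]addrC.
  rewrite big_split /= low.
  under [X in _ + X]eq_bigr => l _ do rewrite (gC p i).
  by rewrite low /K (dC j i); field.
Qed.

Lemma gram_sym (R : realType) (n s : nat) (p : 'rV[R]_(n + n + s)) :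
  (gram p)^T = gram p.
Proof.
apply/matrixP => i j; rewrite !mxE /metric; congr (_ + _ * _).
  by apply: eq_bigr => a _; rewrite mulrC.
by apply: eq_bigr => a _; congr (_ + _); rewrite mulrC.
Qed.

Lemma gram_unit (R : realType) (n s : nat) (p : 'rV[R]_(n + n + s)) :
  gram p \in unitmx.
Proof.
have etaD a k (X Y : 'rV[R]_(n + n + s)) :
    eta a p (k *: X + Y) = k * eta a p X + eta a p Y.
  have E : \sum_(i < n) p 0 (iy s i) * (k *: X + Y) 0 (ix s i)
      = k * (\sum_(i < n) p 0 (iy s i) * X 0 (ix s i))
        + \sum_(i < n) p 0 (iy s i) * Y 0 (ix s i).
    by rewrite mulr_sumr -big_split /=; apply: eq_bigr => i _; rewrite !mxE; ring.
  by rewrite /eta E !mxE; ring.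
have metD k (X Y Z : 'rV[R]_(n + n + s)) :
    metric p (k *: X + Y) Z = k * metric p X Z + metric p Y Z.
  rewrite /metric mulrDr addrACA; congr (_ + _).
    by rewrite mulr_sumr -big_split /=; apply: eq_bigr => a _; rewrite etaD; ring.
  rewrite mulrCA -mulrDr; congr (_ * _).
  by rewrite mulr_sumr -big_split /=; apply: eq_bigr => i _; rewrite !mxE; ring.
have met0 Z : metric p 0 Z = 0.
  by have := metD (-1) 0 0 Z; rewrite scaler0 addr0; lra.
have metsum (v Z : 'rV[R]_(n + n + s)) :
    metric p v Z = \sum_i v 0 i * metric p (delta_mx 0 i) Z.
  rewrite {1}(row_sum_delta v).
  elim/big_rec2: _ => [|i x y _ <-]; first exact: met0.
  by rewrite metD.
have metC X Y : metric p X Y = metric p Y X.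
  rewrite /metric; congr (_ + _ * _).
    by apply: eq_bigr => a _; rewrite mulrC.
  by apply: eq_bigr => a _; congr (_ + _); rewrite mulrC.
rewrite -row_free_unit -kermx_eq0; apply/eqP/row_matrixP => r.
rewrite row0; set v := row r _.
have v0 : v *m gram p = 0 by rewrite -row_mul mulmx_ker row0.
have vv : metric p v v = 0.
  rewrite metsum big1 // => i _.
  suff -> : metric p (delta_mx 0 i) v = 0 by rewrite mulr0.
  rewrite metC metsum; transitivity ((v *m gram p) 0 i); last by rewrite v0 mxE.
  rewrite [RHS]mxE.
  by apply: eq_bigr => j _; congr (_ * _); rewrite [RHS]mxE.
have sq (x : R) : 0 <= x * x by rewrite -expr2 sqr_ge0.
move: vv => /eqP; rewrite /metric paddr_eq0; last 2 first.
- by rewrite sumr_ge0.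
- by rewrite mulr_ge0 ?invr_ge0 // sumr_ge0 // => i _; rewrite addr_ge0.
rewrite mulf_eq0 invr_eq0 (negbTE (_ : (4:R) != 0)) ?pnatr_eq0 //=.
rewrite psumr_eq0 // psumr_eq0; last by move=> i _; rewrite addr_ge0.
move=> /andP[/allP ez /allP exy].
have xy i : v 0 (ix s i) = 0 /\ v 0 (iy s i) = 0.
  move: (exy i (mem_index_enum _)); rewrite /= paddr_eq0 // !mulf_eq0 !orbb.
  by move=> /andP[/eqP -> /eqP ->].
have z a : v 0 (iz n a) = 0.
  move: (ez a (mem_index_enum _)); rewrite /= mulf_eq0 orbb /eta.
  rewrite mulf_eq0 invr_eq0 pnatr_eq0 /= big1 ?subr0; first by move/eqP.
  by move=> i _; rewrite (xy i).1 mulr0.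
apply/rowP => k; rewrite [RHS]mxE.
case: (split_ordP k) => [k' ->|a ->]; last exact: z.
by case: (split_ordP k') => i ->; [exact: (xy i).1|exact: (xy i).2].
Qed.

(* Main.v *)
Require Import Defs.
From mathcomp Require Import all_boot all_order all_algebra.
From mathcomp Require Import all_classical all_reals all_analysis.
From mathcomp Require Import ring lra.
Set Implicit Arguments.
Unset Strict Implicit.
Unset Printing Implicit Defensive.
Import Order.TTheory GRing.Theory Num.Theory.
Import numFieldNormedType.Exports.
Local Open Scope classical_set_scope.
Local Open Scope ring_scope.

(* Lowering the index of the Lorentz equation with the invertible Gram matrix
   removes the inverse metric from the Christoffel symbols. With
   mu = -q + 2 sum_a eta^a(T) the lowered equation is equivalent to
   x'' = mu y', y'' = -mu x' together with the constancy of every eta^a(T).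
   For a slant curve mu is the constant lambda, so that (x', y') rotates with
   angular velocity -lambda (or is constant when lambda = 0), and the slant
   condition z_a' = 2 cos theta + sum_i y_i x_i' determines z_a by one more
   integration. Unit speed fixes the norm of (x', y'). *)

(** * Calculus on an interval and polar coordinates *)

Lemma is_derive_coord (R : realType) (m : nat) (V : R -> 'rV[R]_m) (t : R)
    (k : 'I_m) :
  derivable V t 1 -> is_derive t 1 (fun u => V u 0 k) ((derive1 V t : 'rV[R]_m) 0 k).
Proof.
move=> dV; rewrite derive1E derive_mx// mxE; apply: derivableP.
by move/derivable_mxP : dV; apply.
Qed.

(** By the mean value theorem on the segment between the two points, which stays inside [I] because
    [I] is an interval. *)
Lemma is_derive0_itv_cst (R : realType) (I : set R) (f : R -> R) (x y : R) :
  is_interval I -> (forall t, I t -> is_derive t (1 : R) f 0) ->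
  I x -> I y -> f x = f y.
Proof.
move=> Iitv df; wlog xy : x y / x <= y.
  by move=> H Ix Iy; case: (leP x y) => [/H|/ltW /H] -> .
move=> Ix Iy.
have Izw z : z \in `[x, y] -> I z.
  by rewrite in_itv /= => xzy; exact: (Iitv x y).
have [z zxy||z _] := MVT_segment xy (f := f) (df := cst 0).
- apply: df; apply: Izw; exact: subset_itv_oo_cc zxy.
- apply: derivable_within_continuous => z /Izw Iz.
  by have [] := df z Iz.
- by rewrite /cst/= mul0r => /subr0_eq.
Qed.

(** Integration of the equations: [f] is a coordinate of the curve, [g] an explicit primitive of its
    velocity, and [c] becomes one of the free constants of the parametrization. *)
Lemma primitive_itv (R : realType) (I : set R) (f g df : R -> R) :
  is_interval I -> I !=set0 ->
  (forall t, I t -> is_derive t (1 : R) f (df t)) ->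
  (forall t, I t -> is_derive t (1 : R) g (df t)) ->
  exists c, forall t, I t -> f t = g t + c.
Proof.
move=> Iitv [t0 It0] dff dfg; exists (f t0 - g t0) => t It.
suff : (f - g) t = (f - g) t0 by rewrite !fctE => <-; ring.
apply: (is_derive0_itv_cst Iitv _ It It0) => u Iu.
by apply: is_derive_eq; [apply: is_deriveB; [exact: dff|exact: dfg]|rewrite subrr].
Qed.

(** Turns two constants of integration into an amplitude [c] and a phase [a]. *)
Lemma polar_coordinates (R : realType) (A B : R) :
  exists c a : R, c * cos a = A /\ c * sin a = B.
Proof.
have s0 : 0 <= A ^+ 2 + B ^+ 2 by rewrite addr_ge0 ?sqr_ge0.
have [/eqP|r0] := eqVneq (A ^+ 2 + B ^+ 2) 0.
  rewrite paddr_eq0 ?sqr_ge0// !sqrf_eq0 => /andP[/eqP -> /eqP ->].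
  by exists 0, 0; rewrite !mul0r.
pose r := Num.sqrt (A ^+ 2 + B ^+ 2).
have rE : r ^+ 2 = A ^+ 2 + B ^+ 2 by rewrite sqr_sqrtr.
have r_neq0 : r != 0 by rewrite -sqrf_eq0 rE.
have r_gt0 : 0 < r by rewrite lt_def r_neq0 sqrtr_ge0.
have Ar : -1 <= A / r <= 1.
  rewrite -ler_norml normrM normfV (gtr0_norm r_gt0) ler_pdivrMr// mul1r.
  rewrite -[leRHS](gtr0_norm r_gt0) -ler_sqr ?nnegrE// !real_normK ?num_real//.
  by rewrite rE lerDl sqr_ge0.
have [_ cosE] := acos_def Ar.
have sinE : (r * sin (acos (A / r))) ^+ 2 = B ^+ 2.
  by rewrite exprMn sin2cos2 cosE expr_div_n mulrBr mulr1 mulrCA divff ?sqrf_eq0// rE; ring.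
have rcos : r * cos (acos (A / r)) = A by rewrite cosE mulrCA divff// mulr1.
(* The squares determine the sine only up to sign; the opposite angle has the same cosine and
   repairs the sign. *)
move/eqP: sinE; rewrite eqf_sqr => /orP[] /eqP sE.
  by exists r, (acos (A / r)).
by exists r, (- acos (A / r)); rewrite cosN sinN mulrN sE opprK.
Qed.

Lemma is_derive_sin_affine (R : realType) (a b t : R) :
  is_derive t 1 (fun u => sin (a * u + b)) (a * cos (a * t + b)).
Proof.
have -> : (fun u => sin (a * u + b)) = @sin R \o (a \*: id + cst b) by [].
by apply: is_derive_eq; rewrite addr0 [a *: 1]mulr1 mulrC.
Qed.

Lemma is_derive_cos_affine (R : realType) (a b t : R) :
  is_derive t 1 (fun u => cos (a * u + b)) (- a * sin (a * t + b)).
Proof.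
have -> : (fun u => cos (a * u + b)) = @cos R \o (a \*: id + cst b) by [].
by apply: is_derive_eq; rewrite addr0 [a *: 1]mulr1 mulrC mulrN mulNr.
Qed.

(** * Trigonometric polynomials and smoothness *)

(** A syntactic class closed under differentiation and large enough for every coordinate formula of
    both families, so that smoothness needs no computation of higher derivatives. *)
Inductive trig_poly (R : realType) : (R -> R) -> Prop :=
| trig_poly_cst c : trig_poly (fun=> c)
| trig_poly_id : trig_poly (fun t => t)
| trig_poly_sin a b : trig_poly (fun t => sin (a * t + b))
| trig_poly_cos a b : trig_poly (fun t => cos (a * t + b))
| trig_polyD f g : trig_poly f -> trig_poly g -> trig_poly (fun t => f t + g t)
| trig_polyM f g : trig_poly f -> trig_poly g -> trig_poly (fun t => f t * g t).

Lemma trig_poly_is_derive (R : realType) (f : R -> R) : trig_poly f ->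
  exists2 df, trig_poly df & forall t, is_derive t (1 : R) f (df t).
Proof.
elim=> [c||a b|a b|{}f g tf [df tdf fdf] tg [dg tdg gdg]
  |{}f g tf [df tdf fdf] tg [dg tdg gdg]].
- by exists (fun=> 0) => [|t]; [exact: trig_poly_cst|exact: is_derive_cst].
- by exists (fun=> 1) => [|t]; [exact: trig_poly_cst|exact: is_derive_id].
- exists (fun t => a * cos (a * t + b)) => [|t]; last exact: is_derive_sin_affine.
  by apply: trig_polyM; [exact: trig_poly_cst|exact: trig_poly_cos].
- exists (fun t => - a * sin (a * t + b)) => [|t]; last exact: is_derive_cos_affine.
  by apply: trig_polyM; [exact: trig_poly_cst|exact: trig_poly_sin].
- by exists (fun t => df t + dg t) => [|t]; [exact: trig_polyD|exact: is_deriveD].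
- exists (fun t => f t * dg t + g t * df t) => [|t]; last exact: is_deriveM.
  by apply: trig_polyD; apply: trig_polyM.
Qed.

Lemma trig_poly_sum (R : realType) (J : finType) (F : J -> R -> R) :
  (forall j, trig_poly (F j)) -> trig_poly (fun t => \sum_j F j t).
Proof.
move=> tF; elim: (index_enum J) => [|j r IH].
  have -> : (fun t => \sum_(j <- [::]) F j t) = fun=> 0.
    by apply/funext => t; rewrite big_nil.
  exact: trig_poly_cst.
have -> : (fun t => \sum_(i <- j :: r) F i t) = fun t => F j t + \sum_(i <- r) F i t.
  by apply/funext => t; rewrite big_cons.
exact: trig_polyD.
Qed.

Lemma trig_poly_smooth_on (R : realType) (m : nat) (I : set R)
    (gamma : R -> 'rV[R]_m) :
  open I ->
  (forall k, exists2 F, trig_poly F & forall t, I t -> gamma t 0 k = F t) ->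
  smooth_on I gamma.
Proof.
move=> Iopen gF k.
(* Induction on the order of differentiation needs a stronger claim than derivability: on [I] the
   [k]-th derivative has trigonometric polynomials as coordinates. Openness of [I] lets this
   agreement be differentiated. *)
suff : exists2 F' : 'I_m -> R -> R, (forall j, trig_poly (F' j)) &
    forall t, I t -> forall j, (derive1n k gamma t : 'rV[R]_m) 0 j = F' j t.
  move=> [F' tF' gF'] t It; apply/derivable_mxP => i j; rewrite (ord1 i).
  have [df _ /(_ t) [dF' _]] := trig_poly_is_derive (tF' j).
  apply: near_eq_derivable dF'; near=> u.
  by rewrite gF'//; near: u; exact: open_nbhs_nbhs.
elim: k => [|k [F' tF' gF']].
  exists (fun j => s2val (cid2 (gF j))) => [j|t It j]; first exact: s2valP.
  exact: (s2valP' (cid2 (gF j))).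
have dF' j : {df | trig_poly df & forall t, is_derive t (1 : R) (F' j) (df t)}.
  by apply: cid2; exact: trig_poly_is_derive.
exists (fun j => s2val (dF' j)) => [j|t It j]; first exact: s2valP.
rewrite derive1nS.
have near_eq j' : \near t, F' j' t = (derive1n k gamma t : 'rV[R]_m) 0 j'.
  near=> u.
  by rewrite gF'//; near: u; exact: open_nbhs_nbhs.
have dg : derivable (derive1n k gamma) t 1.
  apply/derivable_mxP => i j'; rewrite (ord1 i).
  by apply: near_eq_derivable (near_eq j') _; have [] := s2valP' (dF' j') t.
have [_ <-] := is_derive_coord j dg.
have [_ <-] := s2valP' (dF' j) t; apply: near_eq_derive; near=> u.
by apply/esym; near: u; exact: near_eq.
Unshelve. all: by end_near. Qed.

(** * Lowering the index of a covariant derivative *)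

Lemma linear_sum_delta (R : realType) (m : nat) (f : 'rV[R]_m -> R) (X : 'rV[R]_m) :
  (forall k X Y, f (k *: X + Y) = k * f X + f Y) ->
  f X = \sum_i X 0 i * f (delta_mx 0 i).
Proof.
move=> flin; have f0 : f 0 = 0 by have := flin (-1) 0 0; rewrite scaler0 addr0; lra.
rewrite {1}(row_sum_delta X).
by elim/big_rec2: _ => [//|i x y _ <-]; rewrite flin.
Qed.

(** Contracting with [g p] cancels the inverse matrix in [christoffel]; symmetry of [g p], hence of
    its inverse, allows the contraction to be written as a product of row vector and matrix. *)
Lemma christoffel_lower (R : realType) (m : nat) (g : 'rV[R]_m -> 'M[R]_m)
    (p : 'rV[R]_m) (i j l : 'I_m) :
  (g p)^T = g p -> g p \in unitmx ->
  \sum_k christoffel g p i j k * g p k l =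
  2^-1 * (partial (fun x => g x j l) i p + partial (fun x => g x i l) j p
     - partial (fun x => g x i j) l p).
Proof.
move=> gsym gunit.
pose K := \row_l (partial (fun x => g x j l) i p + partial (fun x => g x i l) j p
     - partial (fun x => g x i j) l p).
have chE : \row_k christoffel g p i j k = 2^-1 *: (K *m invmx (g p)).
  apply/rowP => k; rewrite !mxE; congr (_ * _).
  by apply: eq_bigr => k' _; rewrite mulrC -[in LHS]gsym -trmx_inv !mxE.
have := congr1 (fun M => (M *m g p) 0 l) chE.
by rewrite -scalemxAl mulmxKV// !mxE => <-; apply: eq_bigr => k _; rewrite mxE.
Qed.

Lemma cov_deriv_lower (R : realType) (m : nat) (g : 'rV[R]_m -> 'M[R]_m)
    (gamma V : R -> 'rV[R]_m) (t : R) (l : 'I_m) :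
  (g (gamma t))^T = g (gamma t) -> g (gamma t) \in unitmx ->
  (cov_deriv g gamma V t *m g (gamma t)) 0 l =
  (derive1 V t *m g (gamma t)) 0 l +
  2^-1 * \sum_i (derive1 gamma t : 'rV[R]_m) 0 i * \sum_j V t 0 j *
    (partial (fun x => g x j l) i (gamma t) + partial (fun x => g x i l) j (gamma t)
     - partial (fun x => g x i j) l (gamma t)).
Proof.
move=> gsym gunit; rewrite [in LHS]mxE [in X in _ = X + _]mxE.
under eq_bigr do rewrite mxE mulrDl.
rewrite big_split/=; congr (_ + _).
under eq_bigr do rewrite mulr_suml.
rewrite exchange_big mulr_sumr; apply: eq_bigr => i _ /=.
under eq_bigr do rewrite mulr_suml.
rewrite exchange_big mulrCA !mulr_sumr; apply: eq_bigr => j _ /=.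
rewrite [X in _ = _ * X]mulrCA -christoffel_lower// !mulr_sumr.
by apply: eq_bigr => k _; ring.
Qed.

(** * The Gram matrix, its derivatives and the lowered acceleration *)

Lemma eta_linear (R : realType) (n s : nat) (a : 'I_s) (p : 'rV[R]_(n + n + s))
    (k : R) (X Y : 'rV[R]_(n + n + s)) :
  eta a p (k *: X + Y) = k * eta a p X + eta a p Y.
Proof.
have E : \sum_(i < n) p 0 (iy s i) * (k *: X + Y) 0 (ix s i)
    = k * (\sum_(i < n) p 0 (iy s i) * X 0 (ix s i))
      + \sum_(i < n) p 0 (iy s i) * Y 0 (ix s i).
  by rewrite mulr_sumr -big_split /=; apply: eq_bigr => i _; rewrite !mxE; ring.
by rewrite /eta E !mxE; ring.
Qed.

Lemma metric_linear (R : realType) (n s : nat) (p : 'rV[R]_(n + n + s))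
    (k : R) (X Y Z : 'rV[R]_(n + n + s)) :
  metric p (k *: X + Y) Z = k * metric p X Z + metric p Y Z.
Proof.
rewrite /metric mulrDr addrACA; congr (_ + _).
  by rewrite mulr_sumr -big_split /=; apply: eq_bigr => a _; rewrite eta_linear; ring.
rewrite mulrCA -mulrDr; congr (_ * _).
by rewrite mulr_sumr -big_split /=; apply: eq_bigr => i _; rewrite !mxE; ring.
Qed.

Lemma mulmx_gram (R : realType) (n s : nat) (p X : 'rV[R]_(n + n + s)) l :
  (X *m gram p) 0 l = metric p X (delta_mx 0 l).
Proof.
rewrite (linear_sum_delta X (fun k U W => metric_linear p k U W (delta_mx 0 l))).
by rewrite mxE; apply: eq_bigr => i _; rewrite mxE.
Qed.

(* Derivative along [v] of the affine function [x |-> eta a x X]. *)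
Definition deta (R : realType) (n s : nat) (v X : 'rV[R]_(n + n + s)) : R :=
  - 2^-1 * \sum_(i < n) v 0 (iy s i) * X 0 (ix s i).

Lemma deta_linearl (R : realType) (n s : nat) (k : R) (v w X : 'rV[R]_(n + n + s)) :
  deta (k *: v + w) X = k * deta v X + deta w X.
Proof.
rewrite /deta mulrCA -mulrDr; congr (_ * _); rewrite mulr_sumr -big_split.
by apply: eq_bigr => i _; rewrite !mxE/=; ring.
Qed.

Lemma deta_linearr (R : realType) (n s : nat) (k : R) (v X Y : 'rV[R]_(n + n + s)) :
  deta v (k *: X + Y) = k * deta v X + deta v Y.
Proof.
rewrite /deta mulrCA -mulrDr; congr (_ * _); rewrite mulr_sumr -big_split.
by apply: eq_bigr => i _; rewrite !mxE/=; ring.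
Qed.

Lemma is_derive_eta (R : realType) (n s : nat) (a : 'I_s)
    (p v X : 'rV[R]_(n + n + s)) :
  is_derive p v (fun x => eta a x X) (deta v X).
Proof.
have coord k : is_derive p v (fun x : 'rV[R]_(n + n + s) => x 0 k) (v 0 k).
  have [d1 d2] := is_derive_id p v.
  apply: DeriveDef; first by move/derivable_mxP : d1; apply.
  by rewrite -[in RHS]d2 derive_mx// mxE.
have -> : (fun x => eta a x X) = cst (2^-1 * X 0 (iz n a)) +
    (- 2^-1) \*: \sum_(i < n) (X 0 (ix s i) \*: fun x : 'rV[R]_(n + n + s) => x 0 (iy s i)).
  apply/funext => x; rewrite /eta !fctE/= fct_sumE [X in _ = _ + X]mulNr mulrBr; congr (_ - _ * _).
  by apply: eq_bigr => i _; rewrite mulrC.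
apply: is_derive_eq; rewrite add0r; congr (_ * _).
by apply: eq_bigr => i _; rewrite mulrC.
Qed.

(** Only the terms [eta a] times [eta a] depend on the base point, the rest of the metric being
    constant, so the product rule yields everything. *)
Lemma partial_gram (R : realType) (n s : nat) (p : 'rV[R]_(n + n + s)) i j k :
  partial (fun x => gram x i j) k p =
  \sum_(a < s) (deta (delta_mx 0 k) (delta_mx 0 i) * eta a p (delta_mx 0 j)
    + eta a p (delta_mx 0 i) * deta (delta_mx 0 k) (delta_mx 0 j)).
Proof.
set X := delta_mx 0 i; set Y := delta_mx 0 j; set v := delta_mx 0 k.
have -> : (fun x => gram x i j) =
    \sum_(a < s) ((fun x => eta a x X) * (fun x => eta a x Y))
    + cst (4^-1 * \sum_(i < n) (X 0 (ix s i) * Y 0 (ix s i)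
                         + X 0 (iy s i) * Y 0 (iy s i))).
  by apply/funext => x; rewrite mxE /metric !fctE fct_sumE.
rewrite /partial; have dX a := is_derive_eta a p v X.
have dY a := is_derive_eta a p v Y.
rewrite derive_val addr0; apply: eq_bigr => a _.
by rewrite addrC; congr (_ + _); exact: mulrC.
Qed.

(** The difference [deta T e - deta e T] is the exterior derivative of the contact form evaluated on
    [T] and [e]; it carries the magnetic-like force. The term [deta T T] completes the derivative of
    [eta a] of the velocity along the curve. *)
Lemma cov_deriv_gram (R : realType) (n s : nat) (gamma : R -> 'rV[R]_(n + n + s)) t l :
  let p := gamma t in
  let T := derive1 gamma t : 'rV[R]_(n + n + s) in
  let e := delta_mx 0 l in
  (cov_deriv (@gram R n s) gamma (derive1 gamma) t *m gram p) 0 l =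
  metric p (derive1 (derive1 gamma) t) e +
  \sum_(a < s) (deta T T * eta a p e + eta a p T * (deta T e - deta e T)).
Proof.
move=> p T e; rewrite cov_deriv_lower ?gram_sym ?gram_unit// mulmx_gram; congr (_ + _).
(* A bilinear form whose sum over [a], at two basis vectors, is the bracket of partial derivatives
   of the Gram matrix; by bilinearity the double sum over the basis is its value at [T], [T]. *)
pose h (a : 'I_s) X Y := (deta X Y * eta a p e + eta a p Y * deta X e)
  + (deta Y X * eta a p e + eta a p X * deta Y e)
  - (deta e X * eta a p Y + eta a p X * deta e Y).
pose H X Y := \sum_a h a X Y.
have Hl Y k X X' : H (k *: X + X') Y = k * H X Y + H X' Y.
  rewrite /H mulr_sumr -big_split; apply: eq_bigr => a _.
  by rewrite /h/= eta_linear !deta_linearl !deta_linearr; ring.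
have Hr X k Y Y' : H X (k *: Y + Y') = k * H X Y + H X Y'.
  rewrite /H mulr_sumr -big_split; apply: eq_bigr => a _.
  by rewrite /h/= eta_linear !deta_linearl !deta_linearr; ring.
transitivity (2^-1 * H T T).
  congr (_ * _); rewrite (linear_sum_delta T (Hl T)); apply: eq_bigr => i _; congr (_ * _).
  rewrite (linear_sum_delta T (Hr _)); apply: eq_bigr => j _; congr (_ * _).
  rewrite !partial_gram -big_split -sumrB; apply: eq_bigr => a _ /=.
  by [].
(* For equal arguments the summands of [h] coincide in pairs, which absorbs the factor one half. *)
by rewrite mulr_sumr; apply: eq_bigr => a _; rewrite /h; field.
Qed.

(** * The Lorentz equation in coordinate components *)

Lemma sum_pick (R : pzRingType) (m : nat) (F : 'I_m -> R) (i : 'I_m) :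
  \sum_j F j * (j == i)%:R = F i.
Proof.
rewrite (bigD1 i)//= eqxx mulr1 big1 ?addr0// => j /negPf ->.
by rewrite mulr0.
Qed.


Definition ord_disj := (eq_lshift, eq_rshift, eq_lrshift, eq_rlshift).

Lemma delta_ix (R : realType) (n s : nat) (i : 'I_n) :
  let e := delta_mx 0 (ix s i) : 'rV[R]_(n + n + s) in
  ((forall j, e 0 (ix s j) = (j == i)%:R) * (forall j, e 0 (iy s j) = 0)
   * (forall a, e 0 (iz n a) = 0))%type.
Proof. by do !split; move=> j; rewrite mxE eqxx/= !ord_disj. Qed.

Lemma delta_iy (R : realType) (n s : nat) (i : 'I_n) :
  let e := delta_mx 0 (iy s i) : 'rV[R]_(n + n + s) in
  ((forall j, e 0 (ix s j) = 0) * (forall j, e 0 (iy s j) = (j == i)%:R)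
   * (forall a, e 0 (iz n a) = 0))%type.
Proof. by do !split; move=> j; rewrite mxE eqxx/= !ord_disj. Qed.

Lemma delta_iz (R : realType) (n s : nat) (a : 'I_s) :
  let e := delta_mx 0 (iz n a) : 'rV[R]_(n + n + s) in
  ((forall j, e 0 (ix s j) = 0) * (forall j, e 0 (iy s j) = 0)
   * (forall b, e 0 (iz n b) = (b == a)%:R))%type.
Proof. by do !split; move=> j; rewrite mxE eqxx/= !ord_disj. Qed.

Lemma phi_coord (R : realType) (n s : nat) (p X : 'rV[R]_(n + n + s)) :
  ((forall i, phi p X 0 (ix s i) = X 0 (iy s i)) *
   (forall i, phi p X 0 (iy s i) = - X 0 (ix s i)) *
   (forall a, phi p X 0 (iz n a) = \sum_(i < n) X 0 (iy s i) * p 0 (iy s i)))%type.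
Proof.
have E k : phi p X 0 k = \sum_(i < n) X 0 (iy s i) * (delta_mx 0 (ix s i) : 'rV[R]__) 0 k
    - \sum_(i < n) X 0 (ix s i) * (delta_mx 0 (iy s i) : 'rV[R]__) 0 k
    + (\sum_(i < n) X 0 (iy s i) * p 0 (iy s i))
      * \sum_(a < s) (delta_mx 0 (iz n a) : 'rV[R]__) 0 k.
  rewrite mxE [X in X + _]mxE [X in _ + X + _]mxE [X in _ + X]mxE !summxE; congr (_ - _ + _ * _);
    by apply: eq_bigr => i _; rewrite ?mxE.
do !split; move=> i; rewrite E.
- rewrite [X in _ - X]big1 ?[X in _ * X]big1 => [||j _]; last 2 first.
  + by move=> j _; rewrite delta_iz.
  + by rewrite delta_iy mulr0.
  rewrite mulr0 subr0 addr0 -(sum_pick (fun j => X 0 (iy s j))).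
  by apply: eq_bigr => j _; rewrite delta_ix eq_sym.
- rewrite [X in X - _]big1 ?[X in _ * X]big1 => [||j _]; last 2 first.
  + by move=> j _; rewrite delta_iz.
  + by rewrite delta_ix mulr0.
  rewrite mulr0 sub0r addr0 -(sum_pick (fun j => X 0 (ix s j))).
  by congr (- _); apply: eq_bigr => j _; rewrite delta_iy eq_sym.
- rewrite [X in X - _]big1 ?[X in _ - X]big1 => [||j _]; last 2 first.
  + by move=> j _; rewrite delta_iy mulr0.
  + by rewrite delta_ix mulr0.
  rewrite subr0 add0r -[RHS]mulr1 -(sum_pick (fun=> 1) i); congr (_ * _).
  by apply: eq_bigr => j _; rewrite delta_iz eq_sym mul1r.
Qed.

Lemma eta_delta_ix (R : realType) (n s : nat) (a : 'I_s) (p : 'rV[R]_(n + n + s)) (i : 'I_n) :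
  eta a p (delta_mx 0 (ix s i)) = - 2^-1 * p 0 (iy s i).
Proof.
rewrite /eta delta_ix; under eq_bigr do rewrite delta_ix.
by rewrite sum_pick; ring.
Qed.

Lemma eta_delta_iy (R : realType) (n s : nat) (a : 'I_s) (p : 'rV[R]_(n + n + s)) (i : 'I_n) :
  eta a p (delta_mx 0 (iy s i)) = 0.
Proof.
by rewrite /eta delta_iy big1 ?subr0 ?mulr0// => j _; rewrite delta_iy mulr0.
Qed.

Lemma eta_delta_iz (R : realType) (n s : nat) (a b : 'I_s) (p : 'rV[R]_(n + n + s)) :
  eta a p (delta_mx 0 (iz n b)) = 2^-1 * (a == b)%:R.
Proof.
by rewrite /eta delta_iz big1 ?subr0// => j _; rewrite delta_iz mulr0.
Qed.

(** The z-components of [phi p X] compensate exactly the [y dx] part of the contact form: [phi]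
    takes horizontal values. *)
Lemma eta_phi (R : realType) (n s : nat) (a : 'I_s) (p X : 'rV[R]_(n + n + s)) :
  eta a p (phi p X) = 0.
Proof.
rewrite /eta phi_coord -sumrB big1 ?mulr0// => i _.
by rewrite phi_coord mulrC subrr.
Qed.

Lemma metric_delta_ix (R : realType) (n s : nat) (p X : 'rV[R]_(n + n + s)) (i : 'I_n) :
  metric p X (delta_mx 0 (ix s i)) =
  4^-1 * X 0 (ix s i) - 2^-1 * p 0 (iy s i) * \sum_a eta a p X.
Proof.
rewrite /metric addrC; congr (_ * _ + _); last rewrite mulr_sumr -sumrN.
  rewrite -(sum_pick (fun j => X 0 (ix s j))); apply: eq_bigr => j _.
  by rewrite !delta_ix mulr0 addr0.
by apply: eq_bigr => a _; rewrite eta_delta_ix; ring.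
Qed.

Lemma metric_delta_iy (R : realType) (n s : nat) (p X : 'rV[R]_(n + n + s)) (i : 'I_n) :
  metric p X (delta_mx 0 (iy s i)) = 4^-1 * X 0 (iy s i).
Proof.
rewrite /metric big1 ?add0r => [|a _]; last by rewrite eta_delta_iy mulr0.
congr (_ * _); rewrite -(sum_pick (fun j => X 0 (iy s j))); apply: eq_bigr => j _.
by rewrite !delta_iy mulr0 add0r.
Qed.

Lemma metric_delta_iz (R : realType) (n s : nat) (p X : 'rV[R]_(n + n + s)) (a : 'I_s) :
  metric p X (delta_mx 0 (iz n a)) = 2^-1 * eta a p X.
Proof.
rewrite /metric [X in _ + _ * X]big1 ?mulr0 ?addr0 => [|i _]; last first.
  by rewrite !delta_iz !mulr0 addr0.
rewrite -(sum_pick (fun b => 2^-1 * eta b p X)); apply: eq_bigr => b _.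
by rewrite eta_delta_iz; ring.
Qed.

(* The first equation says that each [eta a (derive1 gamma)] is constant, see
   [is_derive_eta_curve]; the frame component along [z_a] of the lowered
   Lorentz equation carries no force since [eta a (phi X) = 0]. *)
Lemma lorentz_iff (R : realType) (n s : nat) (q : R)
    (gamma : R -> 'rV[R]_(n + n + s)) (t : R) :
  let p := gamma t in
  let T := derive1 gamma t : 'rV[R]_(n + n + s) in
  let A := derive1 (derive1 gamma) t : 'rV[R]_(n + n + s) in
  let mu := - q + 2 * \sum_a eta a p T in
  cov_deriv (@gram R n s) gamma (derive1 gamma) t = - q *: phi p T <->
  [/\ forall a, eta a p A + deta T T = 0,
      forall i, A 0 (ix s i) = mu * T 0 (iy s i) &
      forall i, A 0 (iy s i) = - mu * T 0 (ix s i)].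
Proof.
move=> p T A mu; set C := cov_deriv _ _ _ t.
pose L l := metric p A (delta_mx 0 l) + \sum_(a < s)
   (deta T T * eta a p (delta_mx 0 l)
    + eta a p T * (deta T (delta_mx 0 l) - deta (delta_mx 0 l) T)).
pose P l := - q * metric p (phi p T) (delta_mx 0 l).
have CE l : (C *m gram p) 0 l = L l by exact: cov_deriv_gram.
have PE l : ((- q *: phi p T) *m gram p) 0 l = P l.
  by rewrite -scalemxAl mxE mulmx_gram.
(* Since the Gram matrix is invertible, the vector equation may be tested on its lowered
   components. *)
have -> : C = - q *: phi p T <-> forall l, L l = P l.
  split=> [E l|E]; first by rewrite -CE -PE E.
  apply: (can_inj (mulmxK (gram_unit p))); apply/rowP => l.
  by rewrite CE PE.
(* [deta] involves no z-component, so the exterior derivative terms vanish on this basis vector. *)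
have Lz a : L (iz n a) = 2^-1 * (eta a p A + deta T T).
  rewrite /L metric_delta_iz mulrDr; congr (_ + _).
  rewrite -(sum_pick (fun=> 2^-1 * deta T T) a); apply: eq_bigr => b _.
  rewrite eta_delta_iz /deta ![in X in _ + X]big1 ?mulr0 ?subrr ?mulr0.
  - by ring.
  - by move=> i _; rewrite delta_iz mul0r.
  - by move=> i _; rewrite delta_iz mulr0.
have Pz a : P (iz n a) = 0 by rewrite /P metric_delta_iz eta_phi !mulr0.
have dTx i : deta T (delta_mx 0 (ix s i)) = - 2^-1 * T 0 (iy s i).
  rewrite /deta; congr (_ * _); rewrite -(sum_pick (fun j => T 0 (iy s j))).
  by apply: eq_bigr => j _; rewrite delta_ix.
have dxT i : deta (delta_mx 0 (ix s i)) T = 0.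
  by rewrite /deta big1 ?mulr0// => j _; rewrite delta_ix mul0r.
have dTy i : deta T (delta_mx 0 (iy s i)) = 0.
  by rewrite /deta big1 ?mulr0// => j _; rewrite delta_iy mulr0.
have dyT i : deta (delta_mx 0 (iy s i)) T = - 2^-1 * T 0 (ix s i).
  rewrite /deta; congr (_ * _); rewrite -(sum_pick (fun j => T 0 (ix s j))).
  by apply: eq_bigr => j _; rewrite delta_iy mulrC.
have Lx i : L (ix s i) = 4^-1 * A 0 (ix s i) - 2^-1 * T 0 (iy s i) * \sum_a eta a p T
    - 2^-1 * p 0 (iy s i) * \sum_a (eta a p A + deta T T).
  rewrite /L metric_delta_ix dTx dxT subr0 -!addrA; congr (_ + _).
  rewrite !mulr_sumr -!sumrN -!big_split; apply: eq_bigr => a _ /=.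
  by rewrite eta_delta_ix; ring.
have Px i : P (ix s i) = - q * (4^-1 * T 0 (iy s i)).
  rewrite /P metric_delta_ix phi_coord big1 ?mulr0 ?subr0// => a _.
  exact: eta_phi.
have Ly i : L (iy s i) = 4^-1 * A 0 (iy s i) + 2^-1 * T 0 (ix s i) * \sum_a eta a p T.
  rewrite /L metric_delta_iy dTy dyT; congr (_ + _).
  rewrite mulr_sumr; apply: eq_bigr => a _ /=.
  by rewrite eta_delta_iy; ring.
have Py i : P (iy s i) = - q * (- 4^-1 * T 0 (ix s i)).
  by rewrite /P metric_delta_iy phi_coord; ring.
split=> [E|[Ez Ex Ey] l].
(* The z-equations come first: they remove the last sum of [Lx], leaving the force law for the
   x-components. *)
- have Ez a : eta a p A + deta T T = 0 by have := E (iz n a); rewrite Lz Pz; lra.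
  split=> // i.
  + have := E (ix s i); rewrite Lx Px (eq_bigr _ (fun a _ => Ez a)) [X in _ - _ * X = _]big1//.
    by rewrite /mu => H; lra.
  + by have := E (iy s i); rewrite Ly Py /mu => H; lra.
- case: (split_ordP l) => [k ->|a ->]; last by rewrite -/(iz n a) Lz Pz Ez mulr0.
  case: (split_ordP k) => i ->.
  + rewrite -/(ix s i) Lx Px (eq_bigr _ (fun a _ => Ez a)) [X in _ - _ * X]big1//.
    by rewrite Ex /mu; field.
  + by rewrite -/(iy s i) Ly Py Ey /mu; field.
Qed.

(** * Reduction of slant normal magnetic curves to a linear system *)

Lemma is_derive_sum_fun (R : realType) (m : nat) (h : 'I_m -> R -> R)
    (dh : 'I_m -> R) (t : R) :
  (forall i, is_derive t (1 : R) (h i) (dh i)) ->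
  is_derive t (1 : R) (fun u => \sum_i h i u) (\sum_i dh i).
Proof.
move=> dh'; have -> : (fun u => \sum_i h i u) = \sum_i h i.
  by apply/funext => u; rewrite fct_sumE.
exact: is_derive_sum.
Qed.

(** The formula for the coordinate is known on [I] only; openness makes it valid near each point,
    which suffices for differentiation. *)
Lemma derive1_coord_on (R : realType) (m : nat) (I : set R) (V : R -> 'rV[R]_m)
    (F dF : R -> R) (k : 'I_m) :
  open I -> (forall t, I t -> derivable V t 1) ->
  (forall t, I t -> V t 0 k = F t) ->
  (forall t, is_derive t (1 : R) F (dF t)) ->
  forall t, I t -> (derive1 V t : 'rV[R]_m) 0 k = dF t.
Proof.
move=> Iopen dV VF dFP t It; have [_ <-] := is_derive_coord k (dV t It).
have [_ <-] := dFP t; apply: near_eq_derive; near=> u.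
by apply: VF; near: u; exact: open_nbhs_nbhs.
Unshelve. all: by end_near. Qed.

(** Both arguments vary: [V] contributes by linearity, the coefficients [y_i] of the form through
    [deta]. *)
Lemma is_derive_eta_curve (R : realType) (n s : nat) (a : 'I_s)
    (gamma V : R -> 'rV[R]_(n + n + s)) (t : R) :
  derivable gamma t 1 -> derivable V t 1 ->
  is_derive t (1 : R) (fun u => eta a (gamma u) (V u))
    (eta a (gamma t) (derive1 V t) + deta (derive1 gamma t) (V t)).
Proof.
move=> dg dV; rewrite /eta /deta; apply: is_derive_eq.
  apply: (@is_deriveM _ _ (cst 2^-1)).
  apply: is_deriveB; first exact: is_derive_coord.
  by apply: is_derive_sum_fun => i; apply: is_deriveM; exact: is_derive_coord.
rewrite scaler0 addr0 mulNr -mulrBr -addrA -opprD -big_split/=.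
congr (_ * (_ - _)); apply: eq_bigr => i _.
by rewrite [X in _ + X = _]mulrC.
Qed.

(** Slantness makes the sum of the [eta a] equal to [s cos theta], which turns [mu] of [lorentz_iff]
    into [lambda]. These forms contribute [s cos theta ^ 2] to the squared speed, so unit speed
    prescribes the norm of the x- and y-velocities. *)
Lemma slant_magnetic_iff (R : realType) (n s : nat) (q theta : R) (I : set R)
    (gamma : R -> 'rV[R]_(n + n + s)) :
  open I -> smooth_on I gamma ->
  let lambda := - q + 2 * s%:R * cos theta in
  let T t := derive1 gamma t : 'rV[R]_(n + n + s) in
  let A t := derive1 (derive1 gamma) t : 'rV[R]_(n + n + s) in
  normal_magnetic_on q I gamma /\ slant_on theta I gamma <->
  forall t, I t ->
  [/\ forall a, T t 0 (iz n a) =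
        2 * cos theta + \sum_(i < n) gamma t 0 (iy s i) * T t 0 (ix s i),
      forall i, A t 0 (ix s i) = lambda * T t 0 (iy s i),
      forall i, A t 0 (iy s i) = - lambda * T t 0 (ix s i) &
      \sum_(i < n) (T t 0 (ix s i) ^+ 2 + T t 0 (iy s i) ^+ 2) =
        4 * (1 - s%:R * cos theta ^+ 2)].
Proof.
move=> Iopen gsm lambda T A.
have slantE : slant_on theta I gamma <-> forall t, I t -> forall a, T t 0 (iz n a) =
    2 * cos theta + \sum_(i < n) gamma t 0 (iy s i) * T t 0 (ix s i).
  split=> H t It a; have := H t It a; rewrite /eta -/(T t).
    by move=> <-; field.
  by move=> ->; field.
have sumE t : I t -> slant_on theta I gamma ->
    \sum_(a < s) eta a (gamma t) (T t) = s%:R * cos theta.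
  move=> It sl; under eq_bigr do rewrite sl//.
  by rewrite sumr_const card_ord mulr_natl.
have speedE t : I t -> slant_on theta I gamma ->
    metric (gamma t) (T t) (T t) = s%:R * cos theta ^+ 2
      + 4^-1 * \sum_(i < n) (T t 0 (ix s i) ^+ 2 + T t 0 (iy s i) ^+ 2).
  move=> It sl; rewrite /metric; congr (_ + _).
  under eq_bigr do rewrite sl//.
  by rewrite sumr_const card_ord mulr_natl.
have lorE t : I t -> slant_on theta I gamma ->
    cov_deriv (@gram R n s) gamma (derive1 gamma) t = - q *: phi (gamma t) (T t) <->
    (forall i, A t 0 (ix s i) = lambda * T t 0 (iy s i)) /\
    (forall i, A t 0 (iy s i) = - lambda * T t 0 (ix s i)).
  move=> It sl; rewrite lorentz_iff -/(T t) -/(A t) sumE// mulrA -/lambda.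
  split=> [[]//|[Ex Ey]]; split=> // a.
  (* The z-equation is the vanishing of the derivative of [eta a] along the curve, which near [t] is
     the constant [cos theta]. *)
  have [_ <-] := is_derive_eta_curve a (gsm 0%N t It) (gsm 1%N t It).
  rewrite -[RHS](derive_cst (cos theta) t (1 : R)); apply: near_eq_derive; near=> u.
  by apply: sl; near: u; exact: open_nbhs_nbhs.
split=> [[[_ us lo] sl] t It|H].
- have [Ex Ey] := (lorE t It sl).1 (lo t It).
  split=> //; first by move=> a; exact: slantE.1.
  by have := us t It; rewrite -/(T t) speedE//; lra.
- have sl : slant_on theta I gamma by apply/slantE => t /H[].
  split=> //; split=> // t It; have [_ Ex Ey sp] := H t It.
    by rewrite -/(T t) speedE// sp; field.
  exact/lorE.
Unshelve. all: by end_near. Qed.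

(** * Derivatives and smoothness of the explicit solutions *)

Lemma is_deriveD_fun (R : realType) (f g : R -> R) (df dg t : R) :
  is_derive t (1 : R) f df -> is_derive t (1 : R) g dg ->
  is_derive t (1 : R) (fun u => f u + g u) (df + dg).
Proof. exact: is_deriveD. Qed.

Lemma is_deriveMl_fun (R : realType) (k : R) (f : R -> R) (df t : R) :
  is_derive t (1 : R) f df -> is_derive t (1 : R) (fun u => k * f u) (k * df).
Proof. exact: (@is_deriveZ _ _ _ f k). Qed.

Lemma is_derive_trig_x (R : realType) (l a b c t : R) : l != 0 ->
  is_derive t (1 : R) (fun u => c / (- l) * sin (- l * u + a) + b)
    (c * cos (- l * t + a)).
Proof. by move=> l0; apply: is_derive_eq; rewrite /GRing.scale/=; field. Qed.

Lemma is_derive_trig_y (R : realType) (l a d c t : R) : l != 0 ->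
  is_derive t (1 : R) (fun u => c / l * cos (- l * u + a) + d)
    (c * sin (- l * t + a)).
Proof. by move=> l0; apply: is_derive_eq; rewrite /GRing.scale/=; field. Qed.

(** Writing [f = - l * u + a i], the double angle formula and [f' = - l] make
    [- (sin (2 f) + 2 f) / (4 l)] a primitive of the squared cosine that appears in the sum of
    [y_i x_i']. *)
Lemma is_derive_trig_z (R : realType) (n : nat) (l k h t : R) (a c d : 'I_n -> R) :
  l != 0 ->
  is_derive t (1 : R) (fun u => 2 * u * k
      - \sum_(i < n) (c i ^+ 2 / (4 * l ^+ 2)
          * (sin (2 * (- l * u + a i)) + 2 * (- l * u + a i))
        + c i * d i / l * sin (- l * u + a i)) + h)
    (2 * k + \sum_(i < n) (c i / l * cos (- l * t + a i) + d i)
                          * (c i * cos (- l * t + a i))).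
Proof.
move=> l0.
have dS i : is_derive t (1 : R) (fun u => c i ^+ 2 / (4 * l ^+ 2)
          * (sin (2 * (- l * u + a i)) + 2 * (- l * u + a i))
        + c i * d i / l * sin (- l * u + a i))
    (- ((c i / l * cos (- l * t + a i) + d i) * (c i * cos (- l * t + a i)))).
  apply: is_derive_eq; rewrite /GRing.scale/=.
  have -> : 2 * (- l * t + a i) = (- l * t + a i) + (- l * t + a i) by ring.
  rewrite cosD; have := cos2Dsin2 (- l * t + a i); set x := cos _; set y := sin _ => xy.
  (* Eliminates the sine, so that only powers of the cosine remain. *)
  have -> : x * x - y * y = 2 * x ^+ 2 - (x ^+ 2 + y ^+ 2) by ring.
  by rewrite xy; field.
have dk : is_derive t (1 : R) (fun u => 2 * u * k) (2 * k).
  by apply: is_derive_eq; rewrite /GRing.scale/=; ring.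
have := is_deriveD_fun (is_deriveB dk (is_derive_sum_fun dS)) (is_derive_cst h t (1 : R)).
by rewrite addr0 sumrN opprK.
Qed.

Lemma is_derive_affine (R : realType) (c d t : R) :
  is_derive t (1 : R) (fun u => c * u + d) c.
Proof. by apply: is_derive_eq; rewrite /GRing.scale/=; ring. Qed.

Lemma is_derive_parabola_z (R : realType) (n : nat) (k h t : R) (c c' d' : 'I_n -> R) :
  is_derive t (1 : R) (fun u => 2 * u * k
      + \sum_(i < n) c i * (c' i / 2 * u ^+ 2 + d' i * u) + h)
    (2 * k + \sum_(i < n) (c' i * t + d' i) * c i).
Proof.
have dS i : is_derive t (1 : R) (fun u => c i * (c' i / 2 * u ^+ 2 + d' i * u))
    ((c' i * t + d' i) * c i).
  by apply: is_derive_eq; rewrite /GRing.scale/=; field.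
have dk : is_derive t (1 : R) (fun u => 2 * u * k) (2 * k).
  by apply: is_derive_eq; rewrite /GRing.scale/=; ring.
have := is_deriveD_fun (is_deriveD_fun dk (is_derive_sum_fun dS)) (is_derive_cst h t (1 : R)).
by rewrite addr0.
Qed.

Ltac trig_poly_tac := repeat first
  [ exact: trig_poly_cst | exact: trig_poly_id | exact: trig_poly_sin | exact: trig_poly_cos
  | apply: trig_polyD | apply: trig_polyM | apply: trig_poly_sum => ? ].

Lemma trig_poly_trig_z (R : realType) (n : nat) (l k h : R) (a c d : 'I_n -> R) :
  trig_poly (fun u => 2 * u * k
      - \sum_(i < n) (c i ^+ 2 / (4 * l ^+ 2)
          * (sin (2 * (- l * u + a i)) + 2 * (- l * u + a i))
        + c i * d i / l * sin (- l * u + a i)) + h).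
Proof.
(* Puts the doubled angle in affine form and the subtraction as a product with [-1], to match the
   constructors of [trig_poly]. *)
have -> : (fun u => 2 * u * k
      - \sum_(i < n) (c i ^+ 2 / (4 * l ^+ 2)
          * (sin (2 * (- l * u + a i)) + 2 * (- l * u + a i))
        + c i * d i / l * sin (- l * u + a i)) + h) =
    (fun u => 2 * u * k
      + -1 * (\sum_(i < n) (c i ^+ 2 / (4 * l ^+ 2)
          * (sin (- (2 * l) * u + 2 * a i) + 2 * (- l * u + a i))
        + c i * d i / l * sin (- l * u + a i))) + h).
  apply/funext => u; rewrite mulN1r; congr (_ - _ + _); apply: eq_bigr => i _.
  by congr (_ * (sin _ + _) + _); ring.
trig_poly_tac.
Qed.

Lemma trig_poly_parabola_z (R : realType) (n : nat) (k h : R) (c c' d' : 'I_n -> R) :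
  trig_poly (fun u => 2 * u * k
      + \sum_(i < n) c i * (c' i / 2 * u ^+ 2 + d' i * u) + h).
Proof.
have -> : (fun u => 2 * u * k
      + \sum_(i < n) c i * (c' i / 2 * u ^+ 2 + d' i * u) + h) =
    (fun u => 2 * u * k
      + \sum_(i < n) c i * (c' i / 2 * (u * u) + d' i * u) + h).
  by apply/funext => u; under eq_bigr do rewrite expr2.
trig_poly_tac.
Qed.

(** * The bound on the contact angle and the rotation system *)

Lemma norm_le_inv_sqrt (R : realType) (s : nat) (x : R) : (0 < s)%N ->
  0 <= 4 * (1 - s%:R * x ^+ 2) -> `|x| <= 1 / Num.sqrt s%:R.
Proof.
move=> s0 H; have sR0 : 0 < s%:R :> R by rewrite ltr0n.
have q0 : 0 < Num.sqrt s%:R :> R by rewrite sqrtr_gt0.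
rewrite ler_pdivlMr// -(@ler_pXn2r _ 2) ?nnegrE ?mulr_ge0 ?sqrtr_ge0//.
rewrite exprMn real_normK ?num_real// sqr_sqrtr ?ler0n// expr1n.
by lra.
Qed.

(** In complex form [w = u + i v] satisfies [w' = - i l w], hence [w] is [c] times the exponential
    of [i (a - l t)]. *)
Lemma rotation_ode_solution (R : realType) (I : set R) (l : R) (u v : R -> R) :
  is_interval I -> I !=set0 ->
  (forall t, I t -> is_derive t (1 : R) u (l * v t)) ->
  (forall t, I t -> is_derive t (1 : R) v (- l * u t)) ->
  exists c a, forall t, I t ->
    u t = c * cos (- l * t + a) /\ v t = c * sin (- l * t + a).
Proof.
move=> Iitv [t0 It0] du dv.
have ds t : is_derive t (1 : R) (fun w => sin (l * w)) (l * cos (l * t)).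
  by apply: is_derive_eq; rewrite /GRing.scale/=; ring.
have dc t : is_derive t (1 : R) (fun w => cos (l * w)) (- l * sin (l * t)).
  by apply: is_derive_eq; rewrite /GRing.scale/=; ring.
(* [(A, B)] is [(u, v)] rotated by the angle [l t], which undoes its rotation. *)
pose A t := u t * cos (l * t) - v t * sin (l * t).
pose B t := u t * sin (l * t) + v t * cos (l * t).
have AE t : I t -> A t = A t0.
  move=> It; apply: (is_derive0_itv_cst Iitv _ It It0) => w Iw.
  apply: (is_derive_eq (is_deriveB (is_deriveM (du w Iw) (dc w))
    (is_deriveM (dv w Iw) (ds w)))).
  by rewrite /GRing.scale/=; ring.
have BE t : I t -> B t = B t0.
  move=> It; apply: (is_derive0_itv_cst Iitv _ It It0) => w Iw.
  apply: (is_derive_eq (is_deriveD (is_deriveM (du w Iw) (ds w))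
    (is_deriveM (dv w Iw) (dc w)))).
  by rewrite /GRing.scale/=; ring.
have [c [a [cA cB]]] := polar_coordinates (A t0) (B t0).
exists c, a => t It; rewrite cosD sinD mulNr cosN sinN.
have xy := cos2Dsin2 (l * t).
split.
(* The inverse rotation recovers [u] from the constants [A] and [B]. *)
- transitivity (A t * cos (l * t) + B t * sin (l * t)).
    by rewrite /A /B -[LHS]mulr1 -xy; ring.
  by rewrite AE// BE// -cA -cB; ring.
- transitivity (B t * cos (l * t) - A t * sin (l * t)).
    by rewrite /A /B -[LHS]mulr1 -xy; ring.
  by rewrite AE// BE// -cA -cB; ring.
Qed.

(** * Integration of the system and verification of both families *)

Theorem theorem4 (R : realType) (n s : nat) (n_gt0 : (0 < n)%N)
    (s_gt0 : (0 < s)%N) (q theta : R) (q_neq0 : q != 0)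
    (I : set R) (I_open : open I) (I_itv : is_interval I) (I_neq0 : I !=set0)
    (gamma : R -> 'rV[R]_(n + n + s)) :
  let lambda := - q + 2 * s%:R * cos theta in
  (normal_magnetic_on q I gamma /\ slant_on theta I gamma) <->
  (`|cos theta| <= 1 / Num.sqrt s%:R /\
   ((lambda != 0 /\
     exists (a b c d : 'I_n -> R) (h : 'I_s -> R),
       let f (i : 'I_n) (t : R) := - lambda * t + a i in
       \sum_(i < n) c i ^+ 2 = 4 * (1 - s%:R * cos theta ^+ 2) /\
       forall t, I t ->
         [/\ forall i : 'I_n,
               gamma t 0 (ix s i) = c i / (- lambda) * sin (f i t) + b i,
             forall i : 'I_n,
               gamma t 0 (iy s i) = c i / lambda * cos (f i t) + d i &
             forall al : 'I_s,
               gamma t 0 (iz n al) =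
                 2 * t * cos theta
                 - \sum_(i < n)
                     (c i ^+ 2 / (4 * lambda ^+ 2)
                        * (sin (2 * f i t) + 2 * f i t)
                      + c i * d i / lambda * sin (f i t))
                 + h al])
    \/
    (lambda = 0 /\
     exists (c d : 'I_(n + n) -> R) (h : 'I_s -> R),
       \sum_(i < n + n) c i ^+ 2 = 4 * (1 - s%:R * cos theta ^+ 2) /\
       forall t, I t ->
         (forall i : 'I_(n + n), gamma t 0 (lshift s i) = c i * t + d i) /\
         (forall al : 'I_s,
            gamma t 0 (iz n al) =
              2 * t * cos theta
              + \sum_(i < n) c (lshift n i)
                  * (c (rshift n i) / 2 * t ^+ 2 + d (rshift n i) * t)
              + h al)))).
Proof.
move=> lambda; split.
- move=> [mag sl]; have [gsm _ _] := mag.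
  have H := (slant_magnetic_iff q theta I_open gsm).1 (conj mag sl).
  pose T t := derive1 gamma t : 'rV[R]_(n + n + s).
  pose A t := derive1 (derive1 gamma) t : 'rV[R]_(n + n + s).
  have dg t k : I t -> is_derive t (1 : R) (fun u => gamma u 0 k) (T t 0 k).
    by move=> It; apply: is_derive_coord; exact: (gsm 0%N).
  have dT t k : I t -> is_derive t (1 : R) (fun u => T u 0 k) (A t 0 k).
    by move=> It; apply: is_derive_coord; exact: (gsm 1%N).
  have [t0 It0] := I_neq0.
  split.
    (* A sum of squares of velocities at [t0] shows that [1 - s cos theta ^ 2] is nonnegative. *)
    apply: norm_le_inv_sqrt => //; have [_ _ _ <-] := H t0 It0.
    by apply: sumr_ge0 => i _; rewrite addr_ge0 ?sqr_ge0.
  have [l0|l0] := eqVneq lambda 0; [right|left]; split=> //.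
  (* For [lambda = 0] the x- and y-accelerations vanish; the constants [c] are the velocities at
     [t0]. *)
  + have TE t k : I t -> T t 0 (lshift s k) = T t0 0 (lshift s k).
      move=> It; apply: (is_derive0_itv_cst (f := fun u => T u 0 _) I_itv _ It It0) => w Iw.
      have [_ Ax Ay _] := H w Iw; apply: (is_derive_eq (dT w _ Iw)).
      case: (split_ordP k) => i ->; [rewrite [LHS]Ax|rewrite [LHS]Ay].
        by rewrite -/lambda l0 mul0r.
      by rewrite -/lambda l0 oppr0 mul0r.
    pose c k := T t0 0 (lshift s k).
    have /choice[d dP] k : exists d, forall t, I t -> gamma t 0 (lshift s k) = c k * t + d.
      (* The reference primitive has offset 0, so the constant of integration is [d] itself; the
         same device produces [b] and [h]. *)
      have [d dP] := primitive_itv I_itv I_neq0 (fun t It => is_derive_eq (dg t _ It) (TE t k It))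
        (fun t _ => is_derive_affine (c k) 0 t).
      by exists d => t It; rewrite dP// addr0.
    have /choice[h hP] al : exists h, forall t, I t -> gamma t 0 (iz n al) =
        2 * t * cos theta
        + \sum_(i < n) c (lshift n i)
            * (c (rshift n i) / 2 * t ^+ 2 + d (rshift n i) * t)
        + h.
      have Tz t : I t -> T t 0 (iz n al) = 2 * cos theta
          + \sum_(i < n) (c (rshift n i) * t + d (rshift n i)) * c (lshift n i).
        move=> It; have [-> _ _ _] := H t It; congr (_ + _); apply: eq_bigr => i _.
        by rewrite (dP _ t It) [X in _ * X](TE t _ It).
      have [h hP] := primitive_itv I_itv I_neq0 (fun t It => is_derive_eq (dg t _ It) (Tz t It))
        (fun t _ => is_derive_parabola_z (cos theta) 0 t _ _ _).
      by exists h => t It; rewrite hP// addr0.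
    exists c, d, h; split; last by move=> t It; split=> ?; [exact: dP|exact: hP].
    by have [_ _ _ <-] := H t0 It0; rewrite big_split_ord/= -big_split.
  + have sol i : exists ca : R * R, forall t, I t ->
        T t 0 (ix s i) = ca.1 * cos (- lambda * t + ca.2) /\
        T t 0 (iy s i) = ca.1 * sin (- lambda * t + ca.2).
      have [||c [a ca]] := @rotation_ode_solution R I lambda
        (fun t => T t 0 (ix s i)) (fun t => T t 0 (iy s i)) I_itv I_neq0.
      * move=> t It; apply: (is_derive_eq (dT t _ It)).
        by have [_ -> _ _] := H t It.
      * move=> t It; apply: (is_derive_eq (dT t _ It)).
        by have [_ _ -> _] := H t It.
      by exists (c, a).
    have /choice[ca caP] := sol; pose c i := (ca i).1; pose a i := (ca i).2.
    have /choice[b bP] i : exists b, forall t, I t -> gamma t 0 (ix s i) =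
        c i / (- lambda) * sin (- lambda * t + a i) + b.
      have [b bP] := primitive_itv I_itv I_neq0
        (fun t It => is_derive_eq (dg t _ It) (caP i t It).1)
        (fun t _ => is_derive_trig_x _ 0 _ t l0).
      by exists b => t It; rewrite bP// addr0.
    have /choice[d dP] i : exists d, forall t, I t -> gamma t 0 (iy s i) =
        c i / lambda * cos (- lambda * t + a i) + d.
      have [d dP] := primitive_itv I_itv I_neq0
        (fun t It => is_derive_eq (dg t _ It) (caP i t It).2)
        (fun t _ => is_derive_trig_y _ 0 _ t l0).
      by exists d => t It; rewrite dP// addr0.
    have /choice[h hP] al : exists h, forall t, I t -> gamma t 0 (iz n al) =
        2 * t * cos theta
        - \sum_(i < n)
            (c i ^+ 2 / (4 * lambda ^+ 2)
               * (sin (2 * (- lambda * t + a i)) + 2 * (- lambda * t + a i))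
             + c i * d i / lambda * sin (- lambda * t + a i))
        + h.
      have Tz t : I t -> T t 0 (iz n al) = 2 * cos theta
          + \sum_(i < n) (c i / lambda * cos (- lambda * t + a i) + d i)
                          * (c i * cos (- lambda * t + a i)).
        (* The slant condition expresses the z-velocity by [y_i] and [x_i'], both already known. *)
        move=> It; have [-> _ _ _] := H t It; congr (_ + _); apply: eq_bigr => i _.
        by rewrite (dP _ t It) [X in _ * X](caP i t It).1.
      have [h hP] := primitive_itv I_itv I_neq0 (fun t It => is_derive_eq (dg t _ It) (Tz t It))
        (fun t _ => is_derive_trig_z (cos theta) 0 t _ _ _ l0).
      by exists h => t It; rewrite hP// addr0.
    exists a, b, c, d, h; split.
      have [_ _ _ <-] := H t0 It0; apply: eq_bigr => i _.
      have [E1 E2] := caP i t0 It0; rewrite -/(T t0) E1 E2 -/(c i) -/(a i).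
      by rewrite !exprMn -mulrDr cos2Dsin2 mulr1.
    by move=> t It; split=> ?; [exact: bP|exact: dP|exact: hP].
- move=> [_ [[l0 [a [b [c [d [h [csum gP]]]]]]]|[l0 [c [d [h [csum gP]]]]]]].
  + have gx i t (It : I t) := let: And3 P _ _ := gP t It in P i.
    have gy i t (It : I t) := let: And3 _ P _ := gP t It in P i.
    have gz al t (It : I t) := let: And3 _ _ P := gP t It in P al.
    (* Conversely, smoothness is read off the formulas first, since the reduction to the linear
       system presupposes it. *)
    have gsm : smooth_on I gamma.
      apply: trig_poly_smooth_on => // k.
      case: (split_ordP k) => [k' ->|al ->]; last by eexists; [|exact: gz]; exact: trig_poly_trig_z.
      by case: (split_ordP k') => i ->; eexists; [|exact: gx| |exact: gy];
        trig_poly_tac.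
    apply/(slant_magnetic_iff q theta I_open gsm).
    (* The x- and y-formulas are differentiated twice; for z the system constrains only the
       velocity. *)
    have Tx i := derive1_coord_on I_open (gsm 0%N) (gx i) (fun t => is_derive_trig_x _ _ _ t l0).
    have Ty i := derive1_coord_on I_open (gsm 0%N) (gy i) (fun t => is_derive_trig_y _ _ _ t l0).
    have Tz al := derive1_coord_on I_open (gsm 0%N) (gz al)
      (fun t => is_derive_trig_z _ _ t _ _ _ l0).
    have Ax i := derive1_coord_on I_open (gsm 1%N) (Tx i)
      (fun t => is_deriveMl_fun (c i) (is_derive_cos_affine _ _ t)).
    have Ay i := derive1_coord_on I_open (gsm 1%N) (Ty i)
      (fun t => is_deriveMl_fun (c i) (is_derive_sin_affine _ _ t)).
    move=> t It; split=> [al|i|i|].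
    * rewrite Tz//; congr (_ + _); apply: eq_bigr => i _.
      by rewrite (gy _ _ It) Tx.
    * by rewrite Ax// Ty// -/lambda; ring.
    * by rewrite Ay// Tx// -/lambda; ring.
    * rewrite -csum; apply: eq_bigr => i _.
      by rewrite Tx// Ty// !exprMn -mulrDr cos2Dsin2 mulr1.
  + have gxy k t (It : I t) := (gP t It).1 k.
    have gz al t (It : I t) := (gP t It).2 al.
    have gsm : smooth_on I gamma.
      apply: trig_poly_smooth_on => // k.
      case: (split_ordP k) => [k' ->|al ->]; eexists; [|exact: gxy| |exact: gz].
        trig_poly_tac.
      exact: trig_poly_parabola_z.
    apply/(slant_magnetic_iff q theta I_open gsm).
    have Txy k := derive1_coord_on I_open (gsm 0%N) (gxy k) (fun t => is_derive_affine _ _ t).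
    have Tz al := derive1_coord_on I_open (gsm 0%N) (gz al)
      (fun t => is_derive_parabola_z _ _ t _ _ _).
    have Axy k := derive1_coord_on I_open (gsm 1%N) (Txy k) (fun t => is_derive_cst _ t (1 : R)).
    move=> t It; split=> [al|i|i|].
    * rewrite Tz//; congr (_ + _); apply: eq_bigr => i _.
      by rewrite (gxy _ _ It) Txy.
    * by rewrite [LHS]Axy// -/lambda l0 mul0r.
    * by rewrite [LHS]Axy// -/lambda l0 oppr0 mul0r.
    * rewrite -csum big_split_ord/= -big_split; apply: eq_bigr => i _.
      by rewrite /= [X in X ^+ 2 + _]Txy// [X in _ + X ^+ 2]Txy.
Qed.
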